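(* Let $\nu\in(0,1]$ and $p=1+\nu$. Let $f:\mathbb{R}^n\to\mathbb{R}$ be Fréchet differentiable with $\nu$-Hölder continuous gradient on $\mathbb{R}^n$ with constant $L_\nu$, let $g:\mathbb{R}^n\to\mathbb{R}\cup\{+\infty\}$ be proper and lower semicontinuous, and set $\varphi:=f+g$. Let $\overline{x}=0$ be a $p$-calm point of $\varphi$ with $\varphi(\overline{x})=0$, and let $g$ be prox-regular at $\overline{x}=0$ for $-\nabla f(\overline{x})\in\partial g(\overline{x})$. Then there exists $\overline{\gamma}>0$ such that for each $\gamma\in(0,\overline{\gamma})$ there exist a neighborhood $U_\gamma$ of $\overline{x}$ and a constant $\mathcal{L}_\nu>0$ such that $\mathbf{T}_{\gamma\varphi}^{p}$ is single-valued and continuous on $U_\gamma$, and in addition $$\|\mathbf{T}_{\gamma\varphi}^{p}(x_1)-\mathbf{T}_{\gamma\varphi}^{p}(x_2)\|\le\mathcal{L}_\nu\|x_1-x_2\|^{\frac{\nu}{2}},\qquad\forall x_1,x_2\in U_\gamma.$$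
   Context: $\|\cdot\|$ and $\langle\cdot,\cdot\rangle$ are the Euclidean norm and inner product on $\mathbb{R}^n$; $\mathbf{B}(\overline{x};r)$ is the open ball with center $\overline{x}$ and radius $r$. A function $h:\mathbb{R}^n\to\mathbb{R}\cup\{+\infty\}$ is proper if it is finite at some point. $f$ has a $\nu$-Hölder continuous gradient with constant $L_\nu\ge 0$ if $\|\nabla f(y)-\nabla f(x)\|\le L_\nu\|y-x\|^\nu$ for all $x,y\in\mathbb{R}^n$. A point $\overline{x}$ with $\psi(\overline{x})<+\infty$ is a $p$-calm point of a proper lower semicontinuous function $\psi:\mathbb{R}^n\to\mathbb{R}\cup\{+\infty\}$ if there is $M>0$ with $\psi(x)+M\|x-\overline{x}\|^p>\psi(\overline{x})$ for all $x\in\mathbb{R}^n$, $x\ne\overline{x}$. For $\psi:\mathbb{R}^n\to\mathbb{R}\cup\{+\infty\}$ and $\overline{x}$ with $\psi(\overline{x})$ finite, the Fréchet (regular) subdifferential is $\widehat{\partial}\psi(\overline{x}):=\{\zeta\in\mathbb{R}^n\mid\liminf_{x\to\overline{x}}\frac{\psi(x)-\psi(\overline{x})-\langle\zeta,x-\overline{x}\rangle}{\|x-\overline{x}\|}\ge0\}$, and the Mordukhovich (limiting) subdifferential $\partial\psi(\overline{x})$ is the set of $\zeta$ for which there exist $x^k\to\overline{x}$ and $\zeta^k\in\widehat{\partial}\psi(x^k)$ with $\psi(x^k)\to\psi(\overline{x})$ and $\zeta^k\to\zeta$. A proper lower semicontinuous $\psi$ is prox-regular at $\overline{x}$ (with $\psi(\overline{x})$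 finite) for $\overline{\zeta}\in\partial\psi(\overline{x})$ if there exist $\varepsilon>0$ and $\rho>0$ such that $\psi(x')\ge\psi(x)+\langle\zeta,x'-x\rangle-\frac{\rho}{2}\|x'-x\|^2$ for all $x'\in\mathbf{B}(\overline{x};\varepsilon)$, whenever $x\in\mathbf{B}(\overline{x};\varepsilon)$, $\zeta\in\partial\psi(x)\cap\mathbf{B}(\overline{\zeta};\varepsilon)$, and $|\psi(x)-\psi(\overline{x})|<\varepsilon$. For $\gamma>0$, the high-order forward-backward splitting mapping (HiFBS) of $\varphi=f+g$ is the set-valued map $$\mathbf{T}_{\gamma\varphi}^{p}(x):=\operatorname*{arg\,min}_{y\in\mathbb{R}^n}\left\{f(x)+\langle\nabla f(x),y-x\rangle+g(y)+\frac{1}{p\gamma}\|x-y\|^p\right\};$$ when it is a singleton it is identified with its unique element. *)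

(* Defs.v *)
From HB Require Import structures.
From mathcomp Require Import all_boot all_order all_algebra.
From mathcomp Require Import all_classical all_reals all_analysis.
Import Order.TTheory GRing.Theory Num.Theory numFieldNormedType.Exports.

Set Implicit Arguments.
Unset Strict Implicit.
Unset Printing Implicit Defensive.

Local Open Scope classical_set_scope.
Local Open Scope ring_scope.

(* R^n is 'rV[R]_n.  The norm `|x| that the library puts on 'rV[R]_n is the
   sup norm; it is only used for the topology (filters, differentiability,
   semicontinuity), which is that of the Euclidean norm.  All metric quantities
   use the Euclidean norm enorm below. *)
Definition inner (R : realType) (n : nat) (x y : 'rV[R]_n) : R :=
  \sum_(i < n) x 0 i * y 0 i.

Definition enorm (R : realType) (n : nat) (x : 'rV[R]_n) : R :=
  Num.sqrt (inner x x).

Definition eball (R : realType) (n : nat) (x : 'rV[R]_n) (r : R) :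
    set 'rV[R]_n :=
  [set y | enorm (y - x) < r].

(* Meaningful at points where f is Frechet differentiable. *)
Definition gradient (R : realType) (n : nat) (f : 'rV[R]_n -> R)
    (x : 'rV[R]_n) : 'rV[R]_n :=
  \row_(i < n) 'D_(delta_mx 0 i) f x.

Definition holder_gradient (R : realType) (n : nat) (nu L : R)
    (f : 'rV[R]_n -> R) : Prop :=
  forall x y : 'rV[R]_n,
    enorm (gradient f y - gradient f x) <= L * enorm (y - x) `^ nu.

(* The first conjunct restricts the codomain to R together with +oo. *)
Definition proper_fun (R : realType) (n : nat) (psi : 'rV[R]_n -> \bar R) :
    Prop :=
  (forall x, psi x != -oo%E) /\ (exists x, psi x \is a fin_num).

Definition calm_point (R : realType) (n : nat) (p : R)
    (psi : 'rV[R]_n -> \bar R) (xbar : 'rV[R]_n) : Prop :=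
  (psi xbar < +oo)%E /\
  exists2 M : R, 0 < M &
    forall x : 'rV[R]_n, x != xbar ->
      (psi xbar < psi x + (M * enorm (x - xbar) `^ p)%:E)%E.

(* The liminf is taken along the punctured neighborhoods of xbar. *)
Definition regular_subdiff (R : realType) (n : nat)
    (psi : 'rV[R]_n -> \bar R) (xbar : 'rV[R]_n) : set 'rV[R]_n :=
  [set zeta | psi xbar \is a fin_num /\
    (0 <= limf_einf
            (fun x : 'rV[R]_n =>
               (psi x - psi xbar - (inner zeta (x - xbar))%:E)
                 * ((enorm (x - xbar))^-1)%:E)
            xbar^')%E].

Definition limiting_subdiff (R : realType) (n : nat)
    (psi : 'rV[R]_n -> \bar R) (xbar : 'rV[R]_n) : set 'rV[R]_n :=
  [set zeta | psi xbar \is a fin_num /\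
    exists (x_ zeta_ : nat -> 'rV[R]_n),
      [/\ x_ k @[k --> \oo] --> xbar,
          forall k, regular_subdiff psi (x_ k) (zeta_ k),
          psi (x_ k) @[k --> \oo] --> psi xbar &
          zeta_ k @[k --> \oo] --> zeta]].

Definition prox_regular (R : realType) (n : nat)
    (psi : 'rV[R]_n -> \bar R) (xbar zetabar : 'rV[R]_n) : Prop :=
  limiting_subdiff psi xbar zetabar /\
  exists eps rho : R, [/\ 0 < eps, 0 < rho &
    forall x zeta : 'rV[R]_n,
      eball xbar eps x ->
      limiting_subdiff psi x zeta -> eball zetabar eps zeta ->
      (`|psi x - psi xbar| < eps%:E)%E ->
      forall x' : 'rV[R]_n, eball xbar eps x' ->
        (psi x + (inner zeta (x' - x) - rho / 2 * enorm (x' - x) ^+ 2)%:E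
           <= psi x')%E].

Definition argmin (R : realType) (T : Type) (h : T -> \bar R) : set T :=
  [set y | forall z, (h y <= h z)%E].

Definition HiFBS (R : realType) (n : nat) (p gamma : R)
    (f : 'rV[R]_n -> R) (g : 'rV[R]_n -> \bar R) (x : 'rV[R]_n) :
    set 'rV[R]_n :=
  argmin (fun y : 'rV[R]_n =>
    ((f x)%:E + (inner (gradient f x) (y - x))%:E + g y
       + ((p * gamma)^-1 * enorm (x - y) `^ p)%:E)%E).

(* Main.v *)
(** Calmness and Hoelder continuity of the gradient make the model at [x] exceed
    its value at [0] outside the ball of radius [3|x|] around [x], so a
    minimizer [y] exists and tends to [0] with [x].  By optimality,
    [- grad f x - |y - x|^(nu - 1) (y - x) / gamma] is a subgradient of [g] at
    [y], close to [- grad f 0] for small [x], so prox-regularity applies.  Adding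
    the prox-regularity inequalities of two minimizers, hypomonotonicity of the
    subgradients (modulus [rho]) competes with the monotonicity of
    [u |-> |u|^(nu - 1) u / gamma], which on the unit ball is strong with
    modulus [nu / gamma].  For small [gamma] the latter wins and leaves
    [|y1 - y2|^2 <= C |x1 - x2|^nu]: this gives uniqueness and the Hoelder
    estimate at once. *)
Require Import Defs.
From HB Require Import structures.
From mathcomp Require Import all_boot all_order all_algebra.
From mathcomp Require Import all_classical all_reals all_analysis.
From mathcomp Require Import ring lra.
Import Order.TTheory GRing.Theory Num.Theory numFieldNormedType.Exports.

Local Open Scope classical_set_scope.
Local Open Scope ring_scope.

Set Implicit Arguments.
Unset Strict Implicit.
Unset Printing Implicit Defensive.

(** * Euclidean inner product and norm, and their relation to the topology *)

Section euclidean.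
Context (R : realType) (n : nat).
Implicit Types (x y z : 'rV[R]_n) (k : R).

Lemma innerC x y : inner x y = inner y x.
Proof. by apply: eq_bigr => i _; rewrite mulrC. Qed.

Lemma innerDl x y z : inner (x + y) z = inner x z + inner y z.
Proof. by rewrite -big_split; apply: eq_bigr => i _; rewrite mxE mulrDl. Qed.

Lemma innerZl k x y : inner (k *: x) y = k * inner x y.
Proof. by rewrite mulr_sumr; apply: eq_bigr => i _; rewrite mxE mulrA. Qed.

Lemma innerNl x y : inner (- x) y = - inner x y.
Proof. by rewrite -scaleN1r innerZl mulN1r. Qed.

Lemma innerBl x y z : inner (x - y) z = inner x z - inner y z.
Proof. by rewrite innerDl innerNl. Qed.

Lemma innerDr x y z : inner x (y + z) = inner x y + inner x z.
Proof. by rewrite !(innerC x) innerDl. Qed.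

Lemma innerZr k x y : inner x (k *: y) = k * inner x y.
Proof. by rewrite !(innerC x) innerZl. Qed.

Lemma innerNr x y : inner x (- y) = - inner x y.
Proof. by rewrite !(innerC x) innerNl. Qed.

Lemma innerBr x y z : inner x (y - z) = inner x y - inner x z.
Proof. by rewrite innerDr innerNr. Qed.

Lemma inner_ge0 x : 0 <= inner x x.
Proof. by apply: sumr_ge0 => i _; rewrite -expr2 sqr_ge0. Qed.

Lemma inner_eq0 x : inner x x = 0 -> x = 0.
Proof.
move=> x0; apply/rowP => i; rewrite mxE; apply/eqP; rewrite -sqrf_eq0 expr2.
apply/eqP/(psumr_eq0P (P := xpredT) (F := fun i => x 0 i * x 0 i)) => // j _.
by rewrite -expr2 sqr_ge0.
Qed.

Lemma enorm_ge0 x : 0 <= enorm x. Proof. exact: sqrtr_ge0. Qed.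

Lemma enorm_sqr x : enorm x ^+ 2 = inner x x.
Proof. by rewrite sqr_sqrtr// inner_ge0. Qed.

Lemma enorm0 : enorm (0 : 'rV[R]_n) = 0.
Proof. by rewrite /enorm -(scale0r 0) innerZl mul0r sqrtr0. Qed.

Lemma enorm_eq0 x : (enorm x == 0) = (x == 0).
Proof.
apply/eqP/eqP => [x0|->]; last exact: enorm0.
by apply: inner_eq0; rewrite -enorm_sqr x0 expr0n.
Qed.

Lemma enorm_gt0 x : (0 < enorm x) = (x != 0).
Proof. by rewrite lt0r enorm_ge0 andbT enorm_eq0. Qed.

Lemma enormN x : enorm (- x) = enorm x.
Proof. by rewrite /enorm innerNl innerNr opprK. Qed.

Lemma enormZ k x : enorm (k *: x) = `|k| * enorm x.
Proof.
by rewrite /enorm innerZl innerZr mulrA -expr2 sqrtrM ?sqr_ge0// sqrtr_sqr.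
Qed.

Lemma enormBC x y : enorm (x - y) = enorm (y - x).
Proof. by rewrite -enormN opprB. Qed.

(** Cauchy-Schwarz: expanding the squared norm of [inner y y *: x - inner x y *: y] gives
    [inner y y] times the difference of the two squared sides. *)
Lemma norm_inner_le x y : `|inner x y| <= enorm x * enorm y.
Proof.
have [->|y0] := eqVneq y 0.
  by rewrite -(scale0r 0) innerZr mul0r normr0 mulr_ge0 ?enorm_ge0.
rewrite -ler_sqr ?nnegrE ?mulr_ge0 ?enorm_ge0// real_normK ?num_real//.
rewrite exprMn !enorm_sqr.
have yy0 : 0 < inner y y by rewrite -enorm_sqr exprn_gt0// enorm_gt0.
have := inner_ge0 (inner y y *: x - inner x y *: y).
rewrite innerBl !innerBr !innerZl !innerZr (innerC y x) => h.
by rewrite -(ler_pM2l yy0); nra.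
Qed.

Lemma inner_le x y : inner x y <= enorm x * enorm y.
Proof. exact: le_trans (ler_norm _) (norm_inner_le x y). Qed.

Lemma inner_ge x y : - (enorm x * enorm y) <= inner x y.
Proof. by rewrite lerNl -innerNl (le_trans (inner_le _ _))// enormN. Qed.

Lemma enormD x y : enorm (x + y) <= enorm x + enorm y.
Proof.
rewrite -ler_sqr ?nnegrE ?addr_ge0 ?enorm_ge0//.
rewrite enorm_sqr innerDl !innerDr sqrrD !enorm_sqr (innerC y x).
by have := inner_le x y; lra.
Qed.

Lemma enormB x y : enorm (x - y) <= enorm x + enorm y.
Proof. by rewrite -(enormN y) enormD. Qed.

Lemma enorm_split z x y : enorm (x - y) <= enorm (x - z) + enorm (z - y).
Proof. by rewrite -[x - y](subrKA z) enormD. Qed.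

(** Bridge from Euclidean estimates to the sup norm, which defines boundedness and convergence
    here. *)
Lemma normr_le_enorm x : `|x| <= enorm x.
Proof.
rewrite [leLHS]/Num.Def.normr /= mx_normrE bigmax_le ?enorm_ge0//= => -[i j] _ /=.
rewrite ord1 -ler_sqr ?nnegrE ?enorm_ge0// real_normK ?num_real// enorm_sqr.
rewrite /inner (bigD1 j)//= -expr2 lerDl sumr_ge0// => k _.
by rewrite -expr2 sqr_ge0.
Qed.

Lemma inner_continuous_fun (T : topologicalType) (u v : T -> 'rV[R]_n) (t : T) :
  {for t, continuous u} -> {for t, continuous v} ->
  {for t, continuous (fun s => inner (u s) (v s))}.
Proof.
move=> cu cv; rewrite /prop_for /continuous_at /inner.
apply: cvg_big => [|i _]; first exact: add_continuous.
apply: (@cvgM R T (nbhs t) _ (fun s => u s 0 i) (fun s => v s 0 i)).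
- exact: (cvg_comp _ _ cu (@coord_continuous R 1 n 0 i (u t))).
- exact: (cvg_comp _ _ cv (@coord_continuous R 1 n 0 i (v t))).
Qed.

Lemma enorm_continuous : continuous (@enorm R n).
Proof.
move=> x; apply: continuous_comp; last exact: sqrt_continuous.
by apply: inner_continuous_fun; exact: cvg_id.
Qed.

Lemma enormB_continuous x : continuous (fun y => enorm (y - x)).
Proof.
move=> y; have h : z - x @[z --> y] --> y - x by exact: (cvgB cvg_id (cvg_cst x)).
exact: (cvg_comp _ _ h (@enorm_continuous (y - x))).
Qed.

Lemma nbhs_eball x (e : R) : 0 < e -> nbhs x (eball x e).
Proof.
move=> e0; have := @enormB_continuous x x.
rewrite /continuous_at subrr enorm0 => c.
by have := c _ (lt_nbhsl e0).
Qed.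

End euclidean.

(** * Inequalities for real powers *)

Section power_inequalities.
Context (R : realType).
Implicit Types a b s t nu p : R.

(** With [t = expR l] and [expR (s * l)] factored out, [1 + u <= expR u] is used at [(1 - s) * l]
    and [- (s * l)]; weighted by [s] and [1 - s], the linear terms cancel and leave 1. *)
Lemma powR_le_tangent1 s t : 0 <= s <= 1 -> 0 <= t -> t `^ s <= 1 + s * (t - 1).
Proof.
move=> /andP[s0 s1]; rewrite le_eqVlt => /predU1P[<-|t0].
  have [->|sn0] := eqVneq s 0; first by rewrite powRr0; lra.
  by rewrite powR0//; lra.
rewrite -{2}(lnK t0) /powR gt_eqF//; set l := ln t.
have q0 := expR_gt0 (s * l).
have h1 : expR l = expR (s * l) * expR ((1 - s) * l) by rewrite -expRD; congr expR; ring.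
have h2 : 1 = expR (s * l) * expR (- (s * l)) by rewrite expRN divff// gt_eqF.
have <- : expR (s * l) * (s * expR ((1 - s) * l) + (1 - s) * expR (- (s * l))) =
    1 + s * (expR l - 1).
  by rewrite mulrDr !(mulrCA (expR (s * l))) -h1 -h2; ring.
rewrite ler_peMr ?expR_ge0//.
have := ler_wpM2l s0 (expR_ge1Dx ((1 - s) * l)).
have s1' : 0 <= 1 - s by lra.
have := ler_wpM2l s1' (expR_ge1Dx (- (s * l))).
lra.
Qed.

(** A concave power lies below its tangent at [a]; homogeneity reduces this to the tangent at 1. *)
Lemma powR_le_tangent s a t : 0 <= s <= 1 -> 0 < a -> 0 <= t ->
  t `^ s <= a `^ s + s * a `^ (s - 1) * (t - a).
Proof.
move=> s01 a0 t0.
have -> : t = a * (t / a) by rewrite mulrCA divff ?mulr1// gt_eqF.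
have ta0 : 0 <= t / a by rewrite divr_ge0// ltW.
rewrite powRM ?(ltW a0)//.
have -> : a `^ (s - 1) = a `^ s / a.
  by rewrite powRB ?powRr1 ?(ltW a0)// (gt_eqF a0) implybT.
have := ler_wpM2l (powR_ge0 a s) (powR_le_tangent1 s01 ta0).
move=> /le_trans; apply; rewrite mulrDr mulr1 lerD2l.
rewrite le_eqVlt; apply/orP; left; apply/eqP; field.
by rewrite gt_eqF.
Qed.

(** The sum is at most twice the larger term, and [2 ^ p <= 4]. *)
Lemma powRD_le4 p a b : 0 <= p <= 2 -> 0 <= a -> 0 <= b ->
  (a + b) `^ p <= 4 * (a `^ p + b `^ p).
Proof.
move=> /andP[p0 p2].
wlog ab : a b / a <= b => [H a0 b0|a0 b0].
  by have [/H|/ltW/H] := leP a b; [exact|rewrite addrC [X in 4 * X]addrC; exact].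
apply: (@le_trans _ _ ((2 * b) `^ p)).
  by apply: ge0_ler_powR; rewrite ?nnegrE ?addr_ge0 ?mulr_ge0//; lra.
rewrite powRM// ler_pM ?powR_ge0//; last by rewrite lerDr powR_ge0.
have -> : 4 = 2 `^ 2%:R :> R by rewrite powR_mulrn//; ring.
by rewrite ler_powR//; lra.
Qed.

Lemma powR1D nu a : 0 < nu -> 0 <= a -> a `^ (1 + nu) = a * a `^ nu.
Proof.
by move=> nu0 a0; rewrite -mulr_powRB1 ?addr_gt0//; congr (_ * _ `^ _); ring.
Qed.

Lemma powR_le1 a nu : 0 <= a <= 1 -> 0 <= nu -> a `^ nu <= 1.
Proof.
move=> /andP[a0 a1] nu0; have <- : 1 `^ nu = 1 :> R by rewrite powR1.
by rewrite ge0_ler_powR// ?nnegrE.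
Qed.

End power_inequalities.

(** * The gradient of the power of the norm: tangent bound and strong monotonicity *)

Section duality_map.
Context (R : realType) (n : nat) (nu : R).
Hypothesis hnu : 0 < nu <= 1.
Implicit Types u v w : 'rV[R]_n.

Let nu_gt0 : 0 < nu. Proof. by case/andP: hnu. Qed.

(* [(1 + nu) *: duality_map nu u] is the gradient of [|.|^(1 + nu)] at [u]. *)
Definition duality_map u : 'rV[R]_n := enorm u `^ (nu - 1) *: u.

(** The zero vector absorbs whatever value [powR] gives to the power of 0. *)
Lemma duality_map0 : duality_map 0 = 0.
Proof. exact: scaler0. Qed.

Lemma enorm_duality_map u : enorm (duality_map u) = enorm u `^ nu.
Proof.
by rewrite enormZ ger0_norm ?powR_ge0// mulrC mulr_powRB1// enorm_ge0.
Qed.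

(** [|w|^(1 + nu)] is a concave power, of exponent [(1 + nu) / 2], of [|w|^2]. Its tangent at
    [|u|^2] is used with [|w|^2 - |u|^2 = 2 <u, w - u> + |w - u|^2]. *)
Lemma enorm_powR_le_tangent u w : u != 0 ->
  enorm w `^ (1 + nu) <= enorm u `^ (1 + nu) +
    (1 + nu) * inner (duality_map u) (w - u) +
    (1 + nu) / 2 * enorm u `^ (nu - 1) * enorm (w - u) ^+ 2.
Proof.
move=> u0; have [nu0 nu1] := andP hnu.
have E (v : 'rV[R]_n) r : (enorm v ^+ 2) `^ (r / 2) = enorm v `^ r.
  by rewrite -powR_mulrn ?enorm_ge0// -powRrM; congr (_ `^ _); field.
have su : 0 < enorm u ^+ 2 by rewrite exprn_gt0// enorm_gt0.
have s01 : 0 <= (1 + nu) / 2 <= 1 by apply/andP; split; lra.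
have := powR_le_tangent s01 su (sqr_ge0 (enorm w)).
rewrite !E.
have -> : (1 + nu) / 2 - 1 = (nu - 1) / 2 by field.
rewrite E => /le_trans; apply.
rewrite -addrA lerD2l /duality_map innerZl !enorm_sqr innerBl !innerBr (innerC w u).
by rewrite le_eqVlt; apply/orP; left; apply/eqP; field.
Qed.

(** The gap between the two sides splits into a radial part, controlled by concavity of [t ^ nu],
    and an angular part, controlled by Cauchy-Schwarz. The unit ball makes the factors
    [|u|^(nu - 1)] and [|v|^(nu - 1)] at least 1. *)
Lemma duality_map_monotone u v : enorm u <= 1 -> enorm v <= 1 ->
  nu * enorm (u - v) ^+ 2 <= inner (duality_map u - duality_map v) (u - v).
Proof.
have [nu0 nu1] := andP hnu.
have ge1 (w : 'rV[R]_n) : w != 0 -> enorm w <= 1 -> 1 <= enorm w `^ (nu - 1).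
  move=> w0 w1; rewrite -[leLHS](powRr0 (enorm w)) ger_powR//; last lra.
  by rewrite enorm_gt0 w0.
have H0 (w : 'rV[R]_n) : enorm w <= 1 ->
    nu * enorm w ^+ 2 <= inner (duality_map w) w.
  have [->|w0 w1] := eqVneq w 0; first by rewrite enorm0 duality_map0 -enorm_sqr enorm0; lra.
  rewrite innerZl -enorm_sqr ler_wpM2r ?sqr_ge0//.
  exact: le_trans nu1 (ge1 _ w0 w1).
wlog ab : u v / enorm v <= enorm u => [H u1 v1|u1 v1].
  have [/H|/ltW/H] := leP (enorm v) (enorm u); first exact.
  move/(_ v1 u1); rewrite enormBC => /le_trans; apply.
  rewrite -(opprB u v) -(opprB (duality_map u)) innerNl innerNr opprK.
  by rewrite lexx.
have [v0|v0] := eqVneq v 0.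
  by rewrite v0 duality_map0 !subr0; exact: H0.
have u0 : u != 0 by rewrite -enorm_gt0 (lt_le_trans _ ab)// enorm_gt0.
have a0 : 0 < enorm u by rewrite enorm_gt0.
have b0 : 0 < enorm v by rewrite enorm_gt0.
have a1 := ge1 _ u0 u1; have b1 := ge1 _ v0 v1.
have nu01 : 0 <= nu <= 1 by rewrite ltW.
have := powR_le_tangent nu01 a0 (ltW b0).
rewrite -!(mulr_powRB1 _ nu0) ?enorm_ge0// => T.
rewrite /duality_map innerBl !innerZl !innerBr enorm_sqr innerBl !innerBr (innerC v u).
rewrite -!enorm_sqr.
have C := inner_le u v.
set a := enorm u in a0 a1 ab T C *; set b := enorm v in b0 b1 ab T C *.
set al := a `^ _ in a1 T *; set be := b `^ _ in b1 T *.
(* Radial part: the tangent to [t ^ nu] at [a] gives slope [nu * al], and [al >= 1]. *)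
have T' : nu * (a - b) <= a * al - b * be.
  have : nu * (a - b) <= nu * al * (a - b).
    by rewrite -mulrA ler_wpM2l ?(ltW nu0)// ler_peMl// subr_ge0.
  lra.
have T2 := ler_wpM2l (_ : 0 <= a - b) T'.
have {}T2 : (a - b) * (nu * (a - b)) <= (a - b) * (a * al - b * be).
  by apply: T2; rewrite subr_ge0.
have C2 : 0 <= (al + be - 2 * nu) * (a * b - inner u v).
  by apply: mulr_ge0; lra.
(* The identity behind the splitting: both terms on the right are nonnegative, by [T2] and [C2]. *)
have : al * (a ^+ 2 - inner u v) - be * (inner u v - b ^+ 2) -
   nu * (a ^+ 2 - inner u v - (inner u v - b ^+ 2)) =
   ((a - b) * (a * al - b * be) - (a - b) * (nu * (a - b))) +
    (al + be - 2 * nu) * (a * b - inner u v) by ring.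
lra.
Qed.

End duality_map.

(** * First-order expansion of a function with Hölder gradient *)

Section descent.
Context (R : realType) (n : nat) (f : 'rV[R]_n -> R).
Hypothesis df : forall x, differentiable f x.
Implicit Types x y v : 'rV[R]_n.

Lemma inner_gradient x v : inner (gradient f x) v = 'D_v f x.
Proof.
rewrite deriveE// [in RHS](row_sum_delta v) linear_sum; apply: eq_bigr => i _.
by rewrite linearZ mxE deriveE// mulrC.
Qed.

Lemma is_derive_line x v (t : R) :
  is_derive t 1 (fun s : R => f (s *: v + x)) (inner (gradient f (t *: v + x)) v).
Proof.
(* The difference quotient along the line is literally that of a directional derivative of [f]. *)
have E : (fun h : R => h^-1 *: (f ((h *: 1 + t) *: v + x) - f (t *: v + x))) =
         (fun h : R => h^-1 *: (f (h *: v + (t *: v + x)) - f (t *: v + x))).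
  by apply/funext => h; rewrite scalerDl addrA [h *: 1]mulr1.
have dv : derivable f (t *: v + x) v by apply: diff_derivable.
apply: DeriveDef; first by rewrite /derivable /= E.
by rewrite inner_gradient /derive /= E.
Qed.

(** The mean value theorem on the segment suffices: it gives the constant [L] instead of the sharper
    [L / (1 + nu)] from integration. *)
Lemma descent_ineq (nu L : R) : 0 < nu -> 0 <= L -> holder_gradient nu L f ->
  forall x y, `|f y - f x - inner (gradient f x) (y - x)| <=
    L * enorm (y - x) `^ (1 + nu).
Proof.
move=> nu0 L0 hf x y.
have cont : {within `[0, 1], continuous (fun s : R => f (s *: (y - x) + x))}.
  apply: continuous_subspaceT => t; apply: differentiable_continuous.
  by apply/derivable1_diffP; have [] := is_derive_line x (y - x) t.
have [c c01] := @MVT R _ _ 0 1 ltr01 (fun t _ => is_derive_line x (y - x) t)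
  cont.
rewrite scale1r subrK scale0r add0r subr0 mulr1 => ->.
move: c01; rewrite in_itv /= => /andP[c0 c1].
rewrite -innerBl (le_trans (norm_inner_le _ _))// powR1D ?enorm_ge0//.
rewrite mulrCA mulrC ler_wpM2l ?enorm_ge0// (le_trans (hf _ _))// ler_wpM2l//.
rewrite addrK enormZ ger0_norm ?(ltW c0)//.
by rewrite ge0_ler_powR ?nnegrE ?mulr_ge0 ?enorm_ge0 ?(ltW nu0) ?(ltW c0)// ler_piMl ?enorm_ge0// ltW.
Qed.

End descent.

(** * Lower semicontinuity and existence of minimizers *)

Section lsc_minimum.
Context (R : realType) (T : topologicalType).

(** The level [a] is split into a level [b] for [g], strictly between [a - q y] and [g y], and the
    level [a - b] for [q]. *)
Lemma lsc_addl (q : T -> R) (g : T -> \bar R) :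
  continuous q -> lower_semicontinuous g ->
  lower_semicontinuous (fun y => (q y)%:E + g y)%E.
Proof.
move=> cq lg y a h.
have [b bg ab] : exists2 b : R, (b%:E < g y)%E & a - q y < b.
  case: (g y) h => [r||] //=.
  - rewrite -EFinD lte_fin => h; exists ((a - q y + r) / 2); rewrite ?lte_fin; lra.
  - by move=> _; exists (a - q y + 1); rewrite ?ltry//; lra.
have nq : \forall z \near y, a - b < q z.
  have := cq y _ (@lt_nbhsr _ (a - b) (q y) _); apply; lra.
have [V nV hV] := lg y b bg.
exists (V `&` [set z | a - b < q z]) => [|z [Vz /= qz]]; first exact: filterI.
have := hV _ Vz; case: (g z) => [r||] //=.
- by rewrite -EFinD !lte_fin; lra.
- by move=> _; rewrite addey ?ltry.
Qed.

(** The sublevel sets [K] cut by [h <= h z] form a filter base on [K]. A cluster point is a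
    minimizer: if [h z < h y], semicontinuity gives a neighborhood of [y] missing the sublevel set
    of [z]. *)
Lemma lsc_attains_min (K : set T) (h : T -> \bar R) :
  compact K -> K !=set0 -> lower_semicontinuous h ->
  exists2 y, K y & forall z, K z -> (h y <= h z)%E.
Proof.
move=> cK [y0 Ky0] lh; apply: contrapT => nomin.
pose F := filter_from K (fun z => K `&` [set y | (h y <= h z)%E]).
have FF : ProperFilter F.
  apply: filter_from_proper => [|z Kz]; last by exists z; split => /=.
  apply: filter_from_filter; first by exists y0.
  move=> z1 z2 K1 K2; have [h12|h21] := leP (h z1) (h z2).
    by exists z1 => // y [Ky /= hy]; do !split => //=; exact: le_trans h12.
  by exists z2 => // y [Ky /= hy]; do !split => //=; exact: le_trans (ltW h21).
have FK : F K by exists y0 => // y [].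
have [y [Ky cly]] := cK F FF FK.
apply: nomin; exists y => // z Kz; rewrite leNgt; apply/negP => zy.
(* Semicontinuity is tested at real levels, while [h z] and [h y] may be infinite. *)
have [a za ay] : exists2 a : R, (h z <= a%:E)%E & (a%:E < h y)%E.
  case: (h z) zy => [r zy||]; first by exists r.
    by rewrite ltNge leey.
  case: (h y) => [r _|_|]; last by rewrite ltxx.
    by exists (r - 1); rewrite ?leNye// lte_fin; lra.
  by exists 0; rewrite ?leNye ?ltry.
have [V nV hV] := lh y a ay.
have [w [[Kw /= wz] Vw]] := cly _ _ (ex_intro2 _ _ z Kz (@subset_refl _ _)) nV.
by have := hV _ Vw; rewrite ltNge (le_trans wz za).
Qed.

End lsc_minimum.

(** * Regular subgradients in epsilon form and local expansion of the power term *)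

Section subgradients.
Context (R : realType) (n : nat).
Implicit Types (x y z u w zeta : 'rV[R]_n) (psi : 'rV[R]_n -> \bar R).

Lemma compact_closed_eball x (r : R) : compact [set y | enorm (y - x) <= r].
Proof.
apply: bounded_closed_compact.
  exists (r + enorm x); split; first exact: num_real.
  move=> t ht y /= hy; apply: le_trans (normr_le_enorm y) _.
  have := enormD (y - x) x; rewrite subrK => /le_trans; apply.
  by apply: le_trans (ltW ht); rewrite lerD2r.
rewrite (_ : [set y | _] = (fun y => enorm (y - x)) @^-1` [set t | t <= r])//.
apply: preimage_closed; last exact: closed_le.
by move=> y _; exact: enormB_continuous.
Qed.

Lemma regular_subdiff_near psi x zeta : psi x \is a fin_num ->
  (forall e : R, 0 < e -> \forall z \near x,
    (psi x + (inner zeta (z - x) - e * enorm (z - x))%:E <= psi z)%E) ->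
  regular_subdiff psi x zeta.
Proof.
move=> fx h; split => //; rewrite limf_einfE.
apply/lee_addgt0Pr => e e0; rewrite -leeBlDr// sub0e.
set V := [set z | (psi x + (inner zeta (z - x) - e * enorm (z - x))%:E <= psi z)%E].
(* On the punctured set every quotient is at least [- e]; removing [x] avoids the quotient with zero
   denominator. *)
apply: (@le_trans _ _ (ereal_inf ((fun z => (psi z - psi x -
   (inner zeta (z - x))%:E) * ((enorm (z - x))^-1)%:E)%E @`
   (V `&` [set z | z != x])))); last first.
  apply: ereal_sup_ubound; exists (V `&` [set z | z != x]) => //.
  rewrite /dnbhs/= /within /=; near=> z => zx; split => //=.
  by near: z; exact: h.
apply: le_ereal_inf_tmp => _ [z [/= Vz zx] <-].
have a0 : 0 < enorm (z - x) by rewrite enorm_gt0 subr_eq0.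
move: Vz; rewrite /V /= -{1 2}(fineK fx); case: (psi z) => [r||] //=.
- rewrite !lee_fin ler_pdivlMr//; lra.
- by move=> _; rewrite gt0_mulye ?leey// lte_fin invr_gt0.
Unshelve. all: by end_near. Qed.

Lemma regular_limiting psi x : regular_subdiff psi x `<=` limiting_subdiff psi x.
Proof.
move=> zeta hz; split; first by case: hz.
by exists (fun=> x), (fun=> zeta); split => //; exact: cvg_cst.
Qed.

Lemma enorm_powR_le_local nu u (e : R) : 0 < nu <= 1 -> 0 < e ->
  exists2 d : R, 0 < d & forall w, enorm (w - u) < d ->
    enorm w `^ (1 + nu) <= enorm u `^ (1 + nu) +
      (1 + nu) * inner (duality_map nu u) (w - u) + e * enorm (w - u).
Proof.
move=> hnu e0; have [nu0 nu1] := andP hnu.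
have [->|u0] := eqVneq u 0.
  have e1 : 0 < e `^ nu^-1 by rewrite powR_gt0.
  exists (e `^ nu^-1) => // w; rewrite subr0 => hw.
  rewrite duality_map0 enorm0 powR0 ?gt_eqF ?addr_gt0// add0r.
  rewrite -[X in inner X _](scale0r w) innerZl mul0r mulr0 add0r.
  rewrite powR1D ?enorm_ge0// mulrC ler_wpM2r ?enorm_ge0//.
  rewrite -[leRHS](powRr1 (ltW e0)) -(mulVf (lt0r_neq0 nu0)) powRrM.
  by rewrite ge0_ler_powR ?(ltW nu0) ?nnegrE ?enorm_ge0 ?powR_ge0 ?(ltW hw).
set K := (1 + nu) / 2 * enorm u `^ (nu - 1).
have K0 : 0 < K by rewrite !mulr_gt0 ?powR_gt0 ?enorm_gt0//; lra.
have d0 : 0 < e / K by rewrite divr_gt0.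
exists (e / K) => // w hw.
apply: le_trans (enorm_powR_le_tangent hnu w u0) _.
rewrite lerD2l -/K expr2 mulrA ler_wpM2r ?enorm_ge0// mulrC -ler_pdivlMr//.
exact: ltW.
Qed.

End subgradients.

(** The absolute value keeps the base nonnegative. Zero is treated by hand, since the derivative of
    the power is only used at positive bases. *)
Lemma continuous_normr_powR (R : realType) (r : R) :
  0 < r -> continuous (fun t : R => `|t| `^ r).
Proof.
move=> r0 t; have [->|t0] := eqVneq t 0.
  rewrite /continuous_at normr0 powR0 ?gt_eqF//.
  apply/cvgrPdist_lt => e e0.
  have d0 : 0 < e `^ r^-1 by rewrite powR_gt0.
  exists (e `^ r^-1) => //= s; rewrite /ball_ /= sub0r normrN => hs.
  rewrite sub0r normrN ger0_norm ?powR_ge0//.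
  rewrite -[ltRHS](powRr1 (ltW e0)) -(mulVf (lt0r_neq0 r0)) powRrM.
  by rewrite gt0_ltr_powR// ?nnegrE ?powR_ge0.
have h : {for `|t|, continuous (fun s : R => s `^ r)}.
  apply: differentiable_continuous; apply/derivable1_diffP.
  by have [] := @is_derive1_powR R r `|t| _; rewrite ?normr_gt0.
exact: (cvg_comp _ _ (@norm_continuous _ R t) h).
Qed.

(** * Minimizers of the forward-backward model: existence, optimality, localization *)

Section forward_backward.
Context (R : realType) (n : nat) (nu L M c : R).
Context (f : 'rV[R]_n -> R) (g : 'rV[R]_n -> \bar R).
Hypothesis hnu : 0 < nu <= 1.
Hypothesis L0 : 0 <= L.
Hypothesis M0 : 0 < M.
Hypothesis hc : 2 * (L + 4 * M) <= c.
Hypothesis df : forall x, differentiable f x.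
Hypothesis hgrad : holder_gradient nu L f.
Hypothesis lsc_g : lower_semicontinuous g.
Hypothesis calm : forall z, ((- f z - M * enorm z `^ (1 + nu))%:E <= g z)%E.
Hypothesis g0 : g 0 = (- f 0)%:E.
Implicit Types x y z : 'rV[R]_n.

Let nu_gt0 : 0 < nu. Proof. by case/andP: hnu. Qed.
Let c_gt0 : 0 < c. Proof. by move: hc L0 M0; lra. Qed.

(* [HiFBS p gamma f g x] is its [argmin] for [p = 1 + nu], [c = (p * gamma)^-1];
   in particular [c * (1 + nu)] below is [gamma^-1]. *)
Definition forward_backward_model x y : \bar R :=
  ((f x)%:E + (inner (gradient f x) (y - x))%:E + g y
     + (c * enorm (x - y) `^ (1 + nu))%:E)%E.

Local Notation model := forward_backward_model.

Lemma model_le_real x y z (s : R) : g y = s%:E -> (model x y <= model x z)%E ->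
  ((s + inner (gradient f x) (y - z) + c * enorm (y - x) `^ (1 + nu)
     - c * enorm (z - x) `^ (1 + nu))%:E <= g z)%E.
Proof.
rewrite /model (enormBC x y) (enormBC x z) !innerBr => ->.
by case: (g z) => [r||] //=; rewrite ?leey// !lee_fin; lra.
Qed.

(** Calmness excludes [-oo]; comparison with the finite model value at 0 excludes [+oo]. *)
Lemma model_le0_real x y : (model x y <= model x 0)%E ->
  exists s : R, g y = s%:E.
Proof.
rewrite /model g0; have := calm y.
by case: (g y) => [r||] //= _; exists r.
Qed.

(** With [X = |x|^(1 + nu)] and [Z = |y - x|^(1 + nu)], calmness and two descent inequalities give
    [c Z <= c X + (L + 4 M) (X + Z)]. By [hc] the last term is at most [c (X + Z) / 2], hence
    [Z <= 3 X]. *)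
Lemma model_le0_bound x y : (model x y <= model x 0)%E ->
  enorm (y - x) <= 3 * enorm x.
Proof.
have [nu0 nu1] := andP hnu; have cM := hc.
move=> h; have [s gs] := model_le0_real h.
have := model_le_real gs h; rewrite g0 lee_fin subr0 sub0r enormN.
have := calm y; rewrite gs lee_fin.
have := descent_ineq df nu_gt0 L0 hgrad x y.
have := descent_ineq df nu_gt0 L0 hgrad x 0.
rewrite sub0r enormN innerNr innerBr !ler_norml => /andP[a1 _] /andP[_ a2] a3 a4.
have p02 : 0 <= 1 + nu <= 2 by apply/andP; split; lra.
have := powRD_le4 p02 (enorm_ge0 (y - x)) (enorm_ge0 x).
have p0 : 0 <= 1 + nu by lra.
have a5 : enorm y `^ (1 + nu) <= (enorm (y - x) + enorm x) `^ (1 + nu).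
  rewrite ge0_ler_powR// ?nnegrE ?addr_ge0 ?enorm_ge0//.
  by rewrite -{1}(subrK x y) enormD.
move=> a6; rewrite leNgt; apply/negP => H.
have a7 : (3 * enorm x) `^ (1 + nu) < enorm (y - x) `^ (1 + nu).
  by rewrite gt0_ltr_powR ?nnegrE ?mulr_ge0 ?enorm_ge0//; lra.
(* Since [3 <= 3 ^ (1 + nu)], the factor 3 on powers passes to the norms. *)
have a8 : 3 * enorm x `^ (1 + nu) <= (3 * enorm x) `^ (1 + nu).
  by rewrite powRM ?enorm_ge0// ler_wpM2r ?powR_ge0// le1r_powR//; lra.
set X := enorm x `^ _ in a1 a4 a6 a7 a8 *.
set Z := enorm (y - x) `^ _ in a2 a4 a6 a7 *.
have a9 : 3 * X < Z by exact: le_lt_trans a8 a7.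
have X0 : 0 <= X by exact: powR_ge0.
have a10 := le_trans a5 a6.
have a11 := ler_wpM2l (ltW M0) a10.
have a12 : 0 < (Z - 3 * X) * c by rewrite mulr_gt0// subr_gt0.
have a13 : 0 <= (c - 2 * (L + 4 * M)) * (X + Z) by rewrite mulr_ge0//; lra.
lra.
Qed.

Lemma lsc_model x : lower_semicontinuous (model x).
Proof.
rewrite (_ : model x = (fun y => (f x + inner (gradient f x) (y - x)
   + c * enorm (y - x) `^ (1 + nu))%:E + g y)%E); last first.
  apply/funext => y; rewrite /model enormBC; case: (g y) => [r||] //=.
  by congr EFin; ring.
apply: lsc_addl lsc_g => y.
have hs : z - x @[z --> y] --> y - x by exact: (cvgB cvg_id (cvg_cst x)).
have h1 : inner (gradient f x) (z - x) @[z --> y] --> inner (gradient f x) (y - x).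
  have := @inner_continuous_fun R n 'rV[R]_n (fun=> gradient f x) (fun z => z - x) y.
  by apply; [exact: cst_continuous|exact: hs].
have h2 : enorm (z - x) `^ (1 + nu) @[z --> y] --> enorm (y - x) `^ (1 + nu).
  have p0 : 0 < 1 + nu by rewrite addr_gt0.
  have h := cvg_comp _ _ (@enormB_continuous R n x y)
    (@continuous_normr_powR R (1 + nu) p0 (enorm (y - x))).
  have -> : (fun z => enorm (z - x) `^ (1 + nu)) =
      (fun t : R => `|t| `^ (1 + nu)) \o (fun z => enorm (z - x)).
    by apply/funext => z /=; rewrite ger0_norm ?enorm_ge0.
  by rewrite -[in X in _ --> X](ger0_norm (enorm_ge0 (y - x))).
have h3 : f x + inner (gradient f x) (z - x) @[z --> y] -->
    f x + inner (gradient f x) (y - x).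
  have k := @cst_continuous 'rV[R]_n R^o (f x) y.
  exact: (cvgD k h1).
have h4 : c * enorm (z - x) `^ (1 + nu) @[z --> y] --> c * enorm (y - x) `^ (1 + nu).
  have k := @cst_continuous 'rV[R]_n R^o c y.
  exact: (cvgM k h2).
by have := cvgD h3 h4; apply.
Qed.

(** A minimizer over the ball of radius [3|x|] around [x] is global: this ball contains 0, and
    outside it the model exceeds its value at 0. *)
Lemma argmin_model_nonempty x : argmin (model x) !=set0.
Proof.
have K0 : [set y | enorm (y - x) <= 3 * enorm x] 0.
  by rewrite /= sub0r enormN; have := enorm_ge0 x; lra.
have [|y Ky hy] := lsc_attains_min (@compact_closed_eball R n x (3 * enorm x))
  _ (@lsc_model x); first by exists 0.
exists y => z.
have [Kz|Kz] := leP (enorm (z - x)) (3 * enorm x); first exact: hy.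
apply: le_trans (hy _ K0) _; apply: ltW; rewrite ltNge; apply/negP.
by move=> /model_le0_bound; rewrite leNgt Kz.
Qed.

(** Fermat rule: minimality bounds [g z] below by a difference of power terms, which the local
    expansion at [y - x] linearizes. Error [e / c] there becomes [e] after multiplication by [c]. *)
Lemma argmin_model_subgradient x y : argmin (model x) y ->
  regular_subdiff g y
    (- gradient f x - (c * (1 + nu)) *: duality_map nu (y - x)).
Proof.
move=> hy; have [s gs] := model_le0_real (hy 0).
apply: regular_subdiff_near => [|e e0]; first by rewrite gs.
have ec0 : 0 < e / c by rewrite divr_gt0.
have [d d0 hd] := enorm_powR_le_local (y - x) hnu ec0.
apply: filterS (nbhs_eball y d0) => z zy.
have := hd (z - x); rewrite opprB subrKA => /(_ zy).
rewrite -(ler_pM2l c_gt0) => h.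
have hm := model_le_real gs (hy z).
apply: le_trans hm.
rewrite gs -EFinD lee_fin innerBl innerNl innerZl.
have E : c * (e / c * enorm (z - y)) = e * enorm (z - y).
  by field; exact: lt0r_neq0.
move: h; rewrite !mulrDr E -(opprB z y) innerNr; lra.
Qed.

(** Supplies every closeness condition that prox-regularity asks for: on the point, the subgradient
    and the value of [g]. *)
Lemma argmin_model_local (eps : R) : 0 < eps ->
  exists2 d : R, 0 < d & forall x y (s : R), enorm x < d -> argmin (model x) y ->
    g y = s%:E ->
    [/\ enorm x <= 4^-1, enorm (y - x) <= 1, enorm y < eps,
      enorm (- gradient f x - (c * (1 + nu)) *: duality_map nu (y - x)
             + gradient f 0) < eps & `|s + f 0| < eps].
Proof.
have [nu0 nu1] := andP hnu; have c0 := c_gt0; move=> eps0.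
set G := enorm (gradient f 0).
have G0 : 0 <= G := enorm_ge0 _.
(* Each quantity to be made small is at most a multiple of [|x|^nu]: [4] for [|y|], [L + 6 c] for
   the subgradient, and at most [4 (G + L + M) + c] for the value. [K] dominates all these
   factors. *)
pose K := 4 + L + 6 * c + 4 * (G + L + M) + 1.
have K0 : 0 < K by rewrite /K; have := L0; have := M0; have := c_gt0; lra.
have eK0 : 0 < eps / K by rewrite divr_gt0.
have d0 : 0 < (eps / K) `^ nu^-1 by rewrite powR_gt0.
exists (Num.min 4^-1 ((eps / K) `^ nu^-1)) => [|x y s].
  by rewrite lt_min d0 andbT; lra.
rewrite lt_min => /andP[x4 xd] hy gs.
have x0 := enorm_ge0 x.
have xnu : enorm x `^ nu < eps / K.
  rewrite -[ltRHS](powRr1 (ltW eK0)) -(mulVf (lt0r_neq0 nu0)) powRrM.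
  by rewrite gt0_ltr_powR// nnegrE ?powR_ge0.
have xKe : K * enorm x `^ nu < eps by rewrite mulrC -ltr_pdivlMr.
have xlex : enorm x <= enorm x `^ nu.
  have [->|xn0] := eqVneq (enorm x) 0; first by rewrite powR_ge0.
  by rewrite ger1_powR// lt0r xn0 x0; lra.
have yx := model_le0_bound (hy 0).
have y4 : enorm y <= 4 * enorm x.
  by rewrite -(subrK x y) (le_trans (enormD _ _))//; lra.
have y0 := enorm_ge0 y.
have yx0 := enorm_ge0 (y - x).
have yx1 : enorm (y - x) <= 1 by lra.
set X := enorm x `^ nu in xnu xKe xlex *.
have Knn (a : R) : 0 <= a -> 0 <= a * X by move=> a0; rewrite mulr_ge0 ?powR_ge0.
have le1p (a : R) : 0 <= a <= 1 -> a `^ (1 + nu) <= a.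
  by move=> /andP[a0 a1]; rewrite powR1D// ler_piMr// powR_le1 ?a0 ?a1 ?(ltW nu0).
have KX : K * X = 4 * X + L * X + 6 * (c * X) + 4 * (G * X + L * X + M * X) + X.
  by rewrite /K; ring.
have LX := Knn L L0; have cX := Knn c (ltW c_gt0).
have GX := Knn G G0; have MX := Knn M (ltW M0).
have X0 : 0 <= X by rewrite powR_ge0.
have gx : enorm (gradient f x - gradient f 0) <= L * X.
  by have := hgrad 0 x; rewrite subr0.
split; [lra|exact: yx1|lra| |].
  have -> : - gradient f x - (c * (1 + nu)) *: duality_map nu (y - x) + gradient f 0
    = - (gradient f x - gradient f 0) - (c * (1 + nu)) *: duality_map nu (y - x).
    by rewrite opprB addrC addrA.
  apply: le_lt_trans (enormB _ _) _; rewrite enormN enormZ.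
  rewrite enorm_duality_map// ger0_norm ?mulr_ge0 ?addr_ge0 ?(ltW c_gt0) ?(ltW nu0)//.
  have h1 : enorm (y - x) `^ nu <= 3 * X.
    apply: (@le_trans _ _ ((3 * enorm x) `^ nu)).
      by rewrite ge0_ler_powR ?nnegrE ?mulr_ge0 ?(ltW nu0).
    by rewrite powRM// ler_wpM2r ?powR_ge0// ler1_powR//; lra.
  have h2 : c * (1 + nu) * enorm (y - x) `^ nu <= (c * 2) * (3 * X).
    by rewrite ler_pM ?mulr_ge0 ?powR_ge0 ?addr_ge0 ?(ltW c_gt0) ?(ltW nu0)// ler_wpM2l ?(ltW c_gt0)//; lra.
  lra.
have yp : enorm y `^ (1 + nu) <= 4 * X by apply: le_trans (le1p _ _) _; lra.
have xp : enorm x `^ (1 + nu) <= X by apply: le_trans (le1p _ _) _; lra.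
have Gy : G * enorm y <= G * (4 * X) by rewrite ler_wpM2l//; lra.
have Myp := ler_wpM2l (ltW M0) yp.
have Lyp := ler_wpM2l L0 yp.
have cxp := ler_wpM2l (ltW c_gt0) xp.
have cyx : 0 <= c * enorm (y - x) `^ (1 + nu) by rewrite mulr_ge0 ?powR_ge0 ?(ltW c_gt0).
rewrite ltr_norml; apply/andP; split.
  have := calm y; rewrite gs lee_fin.
  have := descent_ineq df nu_gt0 L0 hgrad 0 y; rewrite subr0 ler_norml => /andP[_ a].
  have := inner_le (gradient f 0) y; rewrite -/G; lra.
have := model_le_real gs (hy 0).
rewrite g0 lee_fin subr0 sub0r enormN.
have := inner_ge (gradient f x) y.
have gxG : enorm (gradient f x) <= G + L * X.
  by rewrite -(subrK (gradient f 0) (gradient f x)) (le_trans (enormD _ _))// -/G; lra.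
have : enorm (gradient f x) * enorm y <= (G + L * X) * enorm y by rewrite ler_wpM2r.
have : L * X * enorm y <= L * X * 1 by rewrite ler_wpM2l//; lra.
lra.
Qed.

End forward_backward.

(** The difference of the two sides is the square of [|x - 2 y|]. *)
Lemma enorm_sqr_le_sub (R : realType) (n : nat) (x y : 'rV[R]_n) :
  enorm x ^+ 2 <= 2 * enorm (x - y) ^+ 2 + 2 * enorm y ^+ 2.
Proof.
have := sqr_ge0 (enorm (x - 2 *: y)).
by rewrite !enorm_sqr !innerBl !innerBr !innerZl !innerZr (innerC y x); lra.
Qed.

(** Here [w = y1 - y2], [e = x1 - x2], and [k] stands for [gamma^-1]. Monotonicity acts on [w - e],
    not [w]; passing to [w] by [|w|^2 <= 2 |w - e|^2 + 2 |e|^2] halves the modulus to [nu k / 2],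
    and [rho] takes at most half of that. The errors are [2 L], [2 k] and [nu k <= k] times
    [|e|^nu]. *)
Lemma prox_regular_estimate (R : realType) (n : nat) (nu k rho L s1 s2 : R)
    (x1 x2 y1 y2 v1 v2 : 'rV[R]_n) :
  0 < nu <= 1 -> 0 < k -> rho <= nu * k / 4 -> 0 <= L ->
  enorm (v1 - v2) <= L * enorm (x1 - x2) `^ nu ->
  s1 + (inner (- v1 - k *: duality_map nu (y1 - x1)) (y2 - y1)
        - rho / 2 * enorm (y2 - y1) ^+ 2) <= s2 ->
  s2 + (inner (- v2 - k *: duality_map nu (y2 - x2)) (y1 - y2)
        - rho / 2 * enorm (y1 - y2) ^+ 2) <= s1 ->
  enorm (y1 - x1) <= 1 -> enorm (y2 - x2) <= 1 ->
  enorm (x1 - x2) <= 1 -> enorm (y1 - y2) <= 2 ->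
  nu * k / 4 * enorm (y1 - y2) ^+ 2 <= (3 * k + 2 * L) * enorm (x1 - x2) `^ nu.
Proof.
move=> hnu k0 rk L0 hv h12 h21 u1 u2 e1 w2; have [nu0 nu1] := andP hnu.
have mono := duality_map_monotone hnu u1 u2.
set J1 := duality_map nu (y1 - x1) in h12 mono *.
set J2 := duality_map nu (y2 - x2) in h21 mono *.
have nJ : enorm (J1 - J2) <= 2.
  rewrite (le_trans (enormB _ _))// !enorm_duality_map//.
  have := @powR_le1 R (enorm (y1 - x1)) nu; have := @powR_le1 R (enorm (y2 - x2)) nu.
  rewrite !enorm_ge0 u1 u2 (ltW nu0) => /(_ isT isT) + /(_ isT isT); lra.
have dE : y1 - x1 - (y2 - x2) = (y1 - y2) - (x1 - x2).
  by rewrite !opprB addrACA [- x1 + _]addrC addrACA.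
rewrite dE in mono.
rewrite (enormBC y2 y1) -(opprB y1 y2) innerNr in h12.
set w := y1 - y2 in h12 h21 mono w2 *; set e := x1 - x2 in mono e1 hv *.
rewrite !innerBl !innerNl (innerZl k) in h12.
rewrite !innerBl !innerNl (innerZl k) in h21.
have Jw : inner (J1 - J2) w = inner J1 w - inner J2 w by rewrite innerBl.
have vw : inner (v1 - v2) w = inner v1 w - inner v2 w by rewrite innerBl.
have Jd : inner (J1 - J2) (w - e) = inner (J1 - J2) w - inner (J1 - J2) e.
  by rewrite innerBr.
have H : inner (v1 - v2) w + k * inner (J1 - J2) w <= rho * enorm w ^+ 2.
  by rewrite vw Jw; lra.
have E0 := enorm_ge0 e; have W0 := enorm_ge0 w.
have eE : enorm e <= enorm e `^ nu.
  have [->|en0] := eqVneq (enorm e) 0; first by rewrite powR_ge0.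
  by rewrite ger1_powR// lt0r en0 E0 e1.
set E := enorm e `^ nu in eE hv *.
have LE : 0 <= L * E by rewrite mulr_ge0 ?powR_ge0.
have b1 : - (L * E * 2) <= inner (v1 - v2) w.
  by apply: le_trans (inner_ge _ _); rewrite lerN2 ler_pM ?enorm_ge0.
have b2 : - (2 * enorm e) <= inner (J1 - J2) e.
  by apply: le_trans (inner_ge _ _); rewrite lerN2 ler_wpM2r.
have par : enorm w ^+ 2 <= 2 * enorm (w - e) ^+ 2 + 2 * enorm e ^+ 2 by exact: enorm_sqr_le_sub.
have ee : enorm e ^+ 2 <= E.
  by apply: le_trans eE; rewrite expr2 ler_piMr.
have c1 := ler_wpM2l (ltW k0) mono.
have nk0 : 0 <= nu * k by rewrite mulr_ge0 ?ltW.
have c2 := ler_wpM2l nk0 par.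
have c3 := ler_wpM2r (sqr_ge0 (enorm w)) rk.
have c4 := ler_wpM2l nk0 ee.
have c5 := ler_wpM2l (ltW k0) b2.
have c6 := ler_wpM2l (ltW k0) eE.
have kE0 : 0 <= k * E by rewrite mulr_ge0 ?powR_ge0 ?ltW.
have c7 : nu * (k * E) <= k * E by rewrite ler_piMl.
rewrite Jd in c1.
clear - H b1 c1 c2 c3 c4 c5 c6 c7 LE.
set W := enorm w ^+ 2 in H c2 c3 *; set D := enorm (w - e) ^+ 2 in c1 c2.
set Q := enorm e ^+ 2 in c2 c4.
set jw := inner (J1 - J2) w in H c1; set je := inner (J1 - J2) e in c1 c5.
lra.
Qed.

(** * Choice of the threshold for [gamma] and derivation of single-valuedness and continuity *)

Unset Implicit Arguments.
Set Strict Implicit.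

Theorem theorem30 (R : realType) (n : nat) (nu p Lnu : R)
    (hnu : 0 < nu <= 1) (hp : p = 1 + nu) (hLnu : 0 <= Lnu)
    (f : 'rV[R]_n -> R) (g : 'rV[R]_n -> \bar R)
    (hf : forall x : 'rV[R]_n, differentiable f x)
    (hgrad : holder_gradient nu Lnu f)
    (hg_proper : proper_fun g) (hg_lsc : lower_semicontinuous g)
    (hcalm : calm_point p (fun x => (f x)%:E + g x)%E 0)
    (hphi0 : ((f 0%R)%:E + g 0%R = 0)%E)
    (hprox : prox_regular g 0 (- gradient f 0)) :
  exists2 gammabar : R, 0 < gammabar &
    forall gamma : R, 0 < gamma < gammabar ->
      exists (U : set 'rV[R]_n) (calL : R),
        [/\ nbhs (0 : 'rV[R]_n) U, 0 < calL &
          exists t : 'rV[R]_n -> 'rV[R]_n,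
            [/\ forall x, U x -> HiFBS p gamma f g x = [set t x],
                {within U, continuous t} &
                forall x1 x2, U x1 -> U x2 ->
                  enorm (t x1 - t x2) <= calL * enorm (x1 - x2) `^ (nu / 2)]].
Proof.
have [nu0 nu1] := andP hnu.
have [_ [M M0 hM]] := hcalm.
have [_ [eps [rho [eps0 rho0 hpr]]]] := hprox.
have g0 : g 0 = (- f 0)%:E.
  move: hphi0; case: (g 0) => [r||] //= [] h; congr EFin; lra.
have calm z : ((- f z - M * enorm z `^ (1 + nu))%:E <= g z)%E.
  have [->|z0] := eqVneq z 0.
    by rewrite g0 lee_fin enorm0 powR0 ?gt_eqF ?addr_gt0//; lra.
  have := hM z z0; rewrite hphi0 subr0 hp.
  have := (hg_proper.1 z); case: (g z) => [r||] //= _; last by rewrite leey.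
  by rewrite lte_fin lee_fin; lra.
(* The first bound gives [2 (Lnu + 4 M) <= c], because [c (1 + nu) = gamma^-1] and [1 + nu <= 2];
   the second gives [rho <= nu / (4 gamma)]. *)
exists (Num.min (4 * (Lnu + 4 * M))^-1 (nu / (4 * rho))).
  by rewrite lt_min invr_gt0 divr_gt0 ?mulr_gt0// ltr_wpDl// mulr_gt0.
move=> gamma /andP[gamma0]; rewrite lt_min => /andP[g1 g2].
pose c := (p * gamma)^-1.
have p0 : 0 < p by rewrite hp addr_gt0.
have LM0 : 0 < Lnu + 4 * M by rewrite ltr_wpDl// mulr_gt0.
have k0 : 0 < gamma^-1 by rewrite invr_gt0.
have ck : c * (1 + nu) = gamma^-1.
  by rewrite /c hp; field; rewrite !gt_eqF//= addr_gt0.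
have hc : 2 * (Lnu + 4 * M) <= c.
  have : 4 * (Lnu + 4 * M) < gamma^-1.
    by rewrite -[ltLHS]invrK ltf_pV2// posrE invr_gt0 mulr_gt0.
  have c0 : 0 < c by rewrite invr_gt0 mulr_gt0.
  have : c * nu <= c * 1 by rewrite ler_wpM2l// ltW.
  by rewrite -ck; lra.
have rk : rho <= nu * gamma^-1 / 4.
  move: g2; rewrite ltr_pdivlMr ?mulr_gt0// => h.
  by rewrite ler_pdivlMr// ler_pdivlMr//; lra.
have HE x : HiFBS p gamma f g x = argmin (forward_backward_model nu c f g x).
  by rewrite /HiFBS /forward_backward_model -hp.
have [d d0 hd] := argmin_model_local hnu hLnu M0 hc hf hgrad calm g0 eps0.
pose C := (3 * gamma^-1 + 2 * Lnu) / (nu * gamma^-1 / 4).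
have nk0 : 0 < nu * gamma^-1 / 4 by rewrite divr_gt0 ?mulr_gt0.
have C0 : 0 < C by rewrite divr_gt0// ltr_pwDl ?mulr_gt0 ?mulr_ge0.
(* Stated for arbitrary minimizers, so that [x1 = x2] yields uniqueness. *)
have est x1 x2 y1 y2 : enorm x1 < d -> enorm x2 < d ->
    argmin (forward_backward_model nu c f g x1) y1 ->
    argmin (forward_backward_model nu c f g x2) y2 ->
    enorm (y1 - y2) <= Num.sqrt C * enorm (x1 - x2) `^ (nu / 2).
  move=> hx1 hx2 m1 m2.
  have [s1 gs1] := model_le0_real calm g0 (m1 0).
  have [s2 gs2] := model_le0_real calm g0 (m2 0).
  have [a1 a2 a3 a4 a5] := hd _ _ _ hx1 m1 gs1.
  have [b1 b2 b3 b4 b5] := hd _ _ _ hx2 m2 gs2.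
  have sub x y s : enorm y < eps -> g y = s%:E -> `|s + f 0| < eps ->
      enorm (- gradient f x - (c * (1 + nu)) *: duality_map nu (y - x)
             + gradient f 0) < eps ->
      argmin (forward_backward_model nu c f g x) y -> forall z (t : R),
      enorm z < eps -> g z = t%:E ->
      s + (inner (- gradient f x - gamma^-1 *: duality_map nu (y - x)) (z - y)
         - rho / 2 * enorm (z - y) ^+ 2) <= t.
    move=> ye gy se ze my z t zeps gz.
    have := hpr y (- gradient f x - gamma^-1 *: duality_map nu (y - x)).
    rewrite /eball /= !subr0 opprK -ck gy g0 -EFinN -EFinD opprK.
    move=> /(_ ye _ ze se z); rewrite subr0 gz -EFinD lee_fin; apply => //.
    apply: regular_limiting.
    exact: (argmin_model_subgradient hnu hLnu M0 hc calm g0 my).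
  have e1 : enorm (x1 - x2) <= 1 by apply: le_trans (enormB _ _) _; lra.
  (* With [|x1|, |x2| <= 1/4], the path through [x1] and [x2] has length at most
     [3/4 + 1/2 + 3/4]. *)
  have w2 : enorm (y1 - y2) <= 2.
    apply: le_trans (enorm_split x1 _ _) _; rewrite (enormBC x1 y2).
    have := model_le0_bound hnu hLnu M0 hc hf hgrad calm g0 (m1 0).
    have := model_le0_bound hnu hLnu M0 hc hf hgrad calm g0 (m2 0).
    have := enorm_split x2 y2 x1; have := enormB x2 x1; lra.
  have := prox_regular_estimate hnu k0 rk hLnu (hgrad x2 x1)
    (sub _ _ _ a3 gs1 a5 a4 m1 _ _ b3 gs2) (sub _ _ _ b3 gs2 b5 b4 m2 _ _ a3 gs1)
    a2 b2 e1 w2.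
  rewrite -ler_pdivlMl// mulrA (mulrC _^-1) -/C => h.
  rewrite -ler_sqr ?nnegrE ?mulr_ge0 ?enorm_ge0 ?sqrtr_ge0 ?powR_ge0//.
  rewrite exprMn (@sqr_sqrtr _ C) ?(ltW C0)// -[X in _ <= _ * X]powR_mulrn ?powR_ge0//.
  by rewrite -powRrM divfK.
exists (eball 0 d), (Num.sqrt C); split; [exact: nbhs_eball|by rewrite sqrtr_gt0|].
(* The default 0 is never taken, since minimizers exist at every [x]. *)
pose t x := xget 0 (argmin (forward_backward_model nu c f g x)).
have tP x : argmin (forward_backward_model nu c f g x) (t x).
  have [y hy] := argmin_model_nonempty hnu hLnu M0 hc hf hgrad hg_lsc calm g0 x.
  exact: xgetPex (ex_intro _ y hy).
have nu20 : 0 < nu / 2 by rewrite divr_gt0.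
have lip x1 x2 : eball 0 d x1 -> eball 0 d x2 ->
    enorm (t x1 - t x2) <= Num.sqrt C * enorm (x1 - x2) `^ (nu / 2).
  by rewrite /eball /= !subr0 => h1 h2; exact: est (tP x1) (tP x2).
exists t; split; last exact: lip.
- move=> x; rewrite /eball /= subr0 HE => hx; apply/seteqP; split => y /=; last by move=> ->.
  move=> hy; have := est _ _ _ _ hx hx hy (tP x).
  rewrite subrr enorm0 powR0 ?gt_eqF// mulr0 => h.
  by apply/eqP; rewrite -subr_eq0 -enorm_eq0 eq_le h enorm_ge0.
(* Continuity follows from the Hölder bound: the radius solves [Num.sqrt C * r ^ (nu / 2) = e]. *)
- apply/subspace_continuousP => x Ux; apply/cvgrPdist_lt => e e0.
  have sC : 0 < Num.sqrt C by rewrite sqrtr_gt0.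
  have es : 0 < e / Num.sqrt C by rewrite divr_gt0.
  have r0 : 0 < (e / Num.sqrt C) `^ (nu / 2)^-1 by rewrite powR_gt0.
  apply: filterS (nbhs_eball x r0) => y; rewrite /eball /= => yx Uy.
  apply: le_lt_trans (normr_le_enorm _) _.
  apply: le_lt_trans (lip _ _ Ux Uy) _.
  rewrite mulrC -ltr_pdivlMr// enormBC.
  rewrite -[ltRHS](powRr1 (ltW es)) -[X in _ < _ `^ X](mulVf (lt0r_neq0 nu20)) [X in _ < X]powRrM.
  by rewrite gt0_ltr_powR// nnegrE ?enorm_ge0 ?powR_ge0.
Qed.
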